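(* Let $\mathbf{A}\in\mathbb{R}^{d\times d}$ satisfy $\|\mathbf{A}\|_2\le1$, and let $\beta=\frac1d\|\mathbf{A}\|_F^2\in[0,1]$. For any positive integer $k<\frac{d}{\beta+1}$, there exist two subsets $\widehat S,\widehat R\subset[d]$ of size $k$ such that $$\|\mathbf{A}_{\widehat S,\widehat R}\|_2\le(1-\beta)\frac kd+2\sqrt{\Big(1-\frac kd\Big)\frac kd\,\beta}.$$
   Context: $[d]=\{1,\dots,d\}$; $\mathbf{A}_{S,R}$ is the submatrix of $\mathbf{A}$ with rows indexed by $S$ and columns indexed by $R$; $\|\cdot\|_2$ is the spectral norm and $\|\cdot\|_F$ the Frobenius norm. *)

(* Defs.v *)
From HB Require Import structures.
From mathcomp Require Import all_boot all_order all_algebra.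
From mathcomp Require Import all_classical all_reals.
Set Implicit Arguments. Unset Strict Implicit. Unset Printing Implicit Defensive.
Import Order.TTheory GRing.Theory Num.Theory.
Local Open Scope ring_scope.
Local Open Scope classical_set_scope.

Definition vnorm {R : realType} {n : nat} (v : 'cV[R]_n) : R :=
  Num.sqrt (\sum_(i < n) v i 0 ^+ 2).

Definition spec_norm {R : realType} {m n : nat} (A : 'M[R]_(m, n)) : R :=
  sup [set vnorm (A *m x) | x in [set x : 'cV[R]_n | vnorm x <= 1]].

Definition frob_norm {R : realType} {m n : nat} (A : 'M[R]_(m, n)) : R :=
  Num.sqrt (\sum_(i < m) \sum_(j < n) A i j ^+ 2).

Definition subm {R : Type} {m n : nat} (A : 'M[R]_(m, n))
  (S : {set 'I_m}) (T : {set 'I_n}) : 'M[R]_(#|S|, #|T|) :=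
  \matrix_(i < #|S|, j < #|T|) A (enum_val i) (enum_val j).

(* Main.v *)
Require Import Defs.
From HB Require Import structures.
From mathcomp Require Import all_boot all_order all_algebra.
From mathcomp Require Import all_classical all_reals.
From mathcomp Require Import ring lra.
Set Implicit Arguments. Unset Strict Implicit. Unset Printing Implicit Defensive.
Import Order.TTheory GRing.Theory Num.Theory.
Local Open Scope ring_scope.

(* A greedy barrier argument. Let Q = x - H be positive definite of size at
   least 2 with tr Q^-1 <= w, and put x' = x - 1/w. Then P = x' - H is still
   positive definite, and deleting the i-th row and column of P changes the trace
   of the inverse to tr P^-1 - (P^-2)_ii / (P^-1)_ii. A Cauchy-Schwarz inequality
   gives (tr P^-1)^2 <= w tr P^-1 + tr P^-2, so some deletion keeps the trace of
   the inverse at most w: one index can be removed while the barrier x drops by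
   1/w. Applied to H = A A^T / b at x = b, this deletes d - k rows. The resulting
   B = A_S satisfies x tr (x - B B^T / b)^-1 - b tr (b - B^T B / x)^-1 = k - d,
   so that B^T B / x starts at barrier b with the same w, and d - k columns can be
   deleted in the same way. Hence the norm of A_(S,R) is at most b - (d - k) / w.
   Convexity bounds w by d (b + beta - 1) / ((b - 1) (b + beta)), and optimising
   over b > 1 gives the theorem. *)

(** * Quadratic forms and positive definite matrices *)

Section PositiveMatrices.
Context {R : realFieldType}.

Definition qform {n : nat} (M : 'M[R]_n) (v : 'cV[R]_n) : R :=
  (v^T *m M *m v) 0 0.

Definition psd {n : nat} (M : 'M[R]_n) : Prop := forall v, 0 <= qform M v.

Definition posdef {n : nat} (M : 'M[R]_n) : Prop :=
  M^T = M /\ forall v, v != 0 -> 0 < qform M v.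

(** The square of [vnorm]; without square roots the matrix arguments run over any
    [realFieldType]. *)
Definition sqnorm {n : nat} (v : 'cV[R]_n) : R := \sum_i v i 0 ^+ 2.

Lemma sqnormE n (v : 'cV[R]_n) : (v^T *m v) 0 0 = sqnorm v.
Proof. by rewrite mxE; apply: eq_bigr => i _; rewrite mxE expr2. Qed.

Lemma sqnorm_ge0 n (v : 'cV[R]_n) : 0 <= sqnorm v.
Proof. by apply: sumr_ge0 => i _; rewrite sqr_ge0. Qed.

Lemma sqnorm_gt0 n (v : 'cV[R]_n) : v != 0 -> 0 < sqnorm v.
Proof.
move=> v0; rewrite lt_def sqnorm_ge0 andbT; apply: contra_neq v0 => s0.
apply/matrixP => i j; rewrite mxE ord1; apply/eqP; rewrite -sqrf_eq0.
move/eqP: s0; rewrite psumr_eq0; last by move=> l _; rewrite sqr_ge0.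
by move/allP/(_ i (mem_index_enum i)).
Qed.

Lemma qformD n (M N : 'M[R]_n) v : qform (M + N) v = qform M v + qform N v.
Proof. by rewrite /qform mulmxDr mulmxDl mxE. Qed.

Lemma qformN n (M : 'M[R]_n) v : qform (- M) v = - qform M v.
Proof. by rewrite /qform mulmxN mulNmx mxE. Qed.

Lemma qformZ n a (M : 'M[R]_n) v : qform (a *: M) v = a * qform M v.
Proof. by rewrite /qform -scalemxAr -scalemxAl mxE. Qed.

Lemma qform_scalar n a (v : 'cV[R]_n) : qform a%:M v = a * sqnorm v.
Proof. by rewrite /qform mul_mx_scalar -scalemxAl mxE sqnormE. Qed.

Lemma qform_congr m n (B : 'M[R]_(m, n)) M v :
  qform (B^T *m M *m B) v = qform M (B *m v).
Proof. by rewrite /qform trmx_mul !mulmxA. Qed.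

Lemma qform_gram m n (B : 'M[R]_(m, n)) v :
  qform (B^T *m B) v = sqnorm (B *m v).
Proof. by rewrite -sqnormE /qform trmx_mul !mulmxA. Qed.

Lemma qform0 n (M : 'M[R]_n) : qform M 0 = 0.
Proof. by rewrite /qform mulmx0 mxE. Qed.

Lemma posdef_psd n (M : 'M[R]_n) : posdef M -> psd M.
Proof.
by move=> [_ M0] v; have [->|/M0/ltW//] := eqVneq v 0; rewrite qform0.
Qed.

Lemma posdef_unit n (M : 'M[R]_n) : posdef M -> M \in unitmx.
Proof.
move=> [MT M0]; rewrite unitmxE unitfE; apply/det0P => -[v v0 vM].
have /M0 : v^T != 0 by rewrite trmx_eq0.
by rewrite /qform trmxK vM mul0mx mxE ltxx.
Qed.

Lemma posdef_inv n (M : 'M[R]_n) : posdef M -> posdef (invmx M).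
Proof.
move=> pM; have uM := posdef_unit pM; case: pM => MT M0.
have iT : (invmx M)^T = invmx M by rewrite trmx_inv MT.
split=> // v v0; have <- : (invmx M)^T *m M *m invmx M = invmx M.
  by rewrite iT mulVmx // mul1mx.
rewrite qform_congr; apply: M0; apply: contra_neq v0 => v0.
by rewrite -[v](mulKVmx uM) v0 mulmx0.
Qed.

Lemma diag_congr m n (B : 'M[R]_(m, n)) M i :
  (B^T *m M *m B) i i = qform M (col i B).
Proof.
rewrite /qform tr_col -row_mul mxE [RHS]mxE; apply: eq_bigr => j _.
by rewrite [row _ _ _ _]mxE [col _ _ _ _]mxE.
Qed.

Lemma mxtrace_congr_ge0 m n (B : 'M[R]_(m, n)) M :
  psd M -> 0 <= \tr (B^T *m M *m B).
Proof. by move=> M0; apply: sumr_ge0 => i _; rewrite diag_congr. Qed.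

Lemma mxtrace_congr_gt0 m n (B : 'M[R]_(m, n)) M :
  posdef M -> B != 0 -> 0 < \tr (B^T *m M *m B).
Proof.
move=> pM B0; rewrite lt_def mxtrace_congr_ge0 ?andbT; last exact: posdef_psd.
apply: contra_neq B0 => /eqP; rewrite psumr_eq0 => [/allP t0|i _]; last first.
  by rewrite diag_congr; exact: posdef_psd.
apply/matrixP => i j; have [c0|/(proj2 pM)] := eqVneq (col j B) 0.
  by move/matrixP: c0 => /(_ i 0); rewrite !mxE.
by rewrite -diag_congr (eqP (t0 j (mem_index_enum j))) ltxx.
Qed.

Lemma posdef_diag_gt0 n (M : 'M[R]_n) i : posdef M -> 0 < M i i.
Proof.
move=> pM; have := @diag_congr n n 1%:M M i.
rewrite trmx1 mul1mx mulmx1 => ->; apply: (proj2 pM).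
by apply/eqP => /matrixP/(_ i 0); rewrite !mxE eqxx => /eqP; rewrite oner_eq0.
Qed.

Lemma posdef_mxtrace_gt0 n (M : 'M[R]_n.+1) : posdef M -> 0 < \tr M.
Proof.
move=> pM; rewrite /mxtrace big_ord_recl ltr_pwDl ?posdef_diag_gt0 //.
by apply: sumr_ge0 => i _; rewrite ltW ?posdef_diag_gt0.
Qed.

(** [E] gathers the columns of the identity picked by [f]: [E^T E = 1] makes it injective, and
    [E^T M E] is the principal submatrix. *)
Lemma posdef_mxsub m n (f : 'I_m -> 'I_n) (M : 'M[R]_n) :
  injective f -> posdef M -> posdef (mxsub f f M).
Proof.
move=> f_inj [MT M0]; split=> [|v v0]; first by rewrite trmx_mxsub MT.
pose E : 'M[R]_(n, m) := colsub f 1%:M.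
have ETE : E^T *m E = 1%:M.
  rewrite /E trmx_mxsub trmx1 -mxsub_mul mul1mx.
  by apply/matrixP => i j; rewrite !mxE (inj_eq f_inj).
have <- : E^T *m M *m E = mxsub f f M.
  by rewrite /E trmx_mxsub trmx1 mul_rowsub_mx mul1mx -mxsub_mul mulmx1.
rewrite qform_congr; apply: M0; apply: contra_neq v0 => v0.
by rewrite -[v]mul1mx -ETE -mulmxA v0 mulmx0.
Qed.

(** The matrix [B = s - v v^T] satisfies [B B = s B], so [0 < tr (B N B) = s (s tr N - v^T N v)].
    Strictness rests on [B != 0], which holds in dimension at least 2. *)
Lemma qform_lt_mxtrace n (N : 'M[R]_n.+2) (v : 'cV[R]_n.+2) :
  posdef N -> v != 0 -> qform N v < \tr N * sqnorm v.
Proof.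
move=> pN v0; set s := sqnorm v; have s0 : 0 < s by apply: sqnorm_gt0.
pose B : 'M[R]_n.+2 := s%:M - v *m v^T.
have trv : \tr (v *m v^T) = s by rewrite mxtrace_mulC trace_mx11 sqnormE.
have BT : B^T = B by rewrite /B linearB /= tr_scalar_mx trmx_mul trmxK.
have B0 : B != 0.
  apply/eqP => /(congr1 mxtrace); rewrite /B linearB /= trv mxtrace_scalar mxtrace0.
  by move/eqP; rewrite mulrS addrC addrK mulrn_eq0 (gt_eqF s0).
have BB : B *m B = s *: B.
  rewrite {2}/B mulmxBr mul_mx_scalar mulmxA {2}/B mulmxBl mul_scalar_mx.
  rewrite -[v *m _ *m v]mulmxA [v^T *m v]mx11_scalar sqnormE mul_mx_scalar.
  by rewrite subrr mul0mx subr0.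
have := mxtrace_congr_gt0 pN B0.
rewrite BT mxtrace_mulC mulmxA BB -scalemxAl mxtraceZ pmulr_rgt0 // mxtrace_mulC.
rewrite /B mulmxBr mul_mx_scalar linearB /= mxtraceZ mulmxA mxtrace_mulC mulmxA.
by rewrite trace_mx11 -/(qform N v) subr_gt0 mulrC.
Qed.

(** Each eigenvalue of [Q^-1] is below its trace, hence below [w], so those of [Q] exceed [1/w].
    Eigenvalues are avoided by expanding the [Q]-form at [v - Q^-1 v / w]. *)
Lemma posdef_sub_scalar n (Q : 'M[R]_n.+2) (w : R) :
  posdef Q -> \tr (invmx Q) <= w -> posdef (Q - w^-1%:M).
Proof.
move=> pQ trw; have pN := posdef_inv pQ; have uQ := posdef_unit pQ.
have w0 : 0 < w by apply: lt_le_trans trw; exact: posdef_mxtrace_gt0.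
split=> [|v v0]; first by rewrite linearB /= tr_scalar_mx (proj1 pQ).
have s0 := sqnorm_gt0 v0.
rewrite qformD qformN qform_scalar subr_gt0.
have : 0 <= qform Q ((1%:M - w^-1 *: invmx Q) *m v).
  exact: posdef_psd.
rewrite -qform_congr.
have -> : (1%:M - w^-1 *: invmx Q)^T *m Q *m (1%:M - w^-1 *: invmx Q) =
   Q - (2 * w^-1)%:M + (w^-1 ^+ 2) *: invmx Q.
  have -> : (1%:M - w^-1 *: invmx Q)^T = 1%:M - w^-1 *: invmx Q.
    by rewrite linearB linearZ /= trmx1 (proj1 pN).
  rewrite mulmxBl mul1mx -scalemxAl mulVmx //.
  rewrite mulmxBr mulmx1 -scalemxAr mulmxBl mulmxV // -scalemxAl mul1mx.
  rewrite scalerBr scalerA !scalemx1 -expr2 mulrDl mul1r [in RHS]raddfD /=.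
  by rewrite !opprD opprK !addrA.
rewrite !qformD qformN qform_scalar qformZ => le0.
have lt1 : qform (invmx Q) v < w * sqnorm v.
  by apply: (lt_le_trans (qform_lt_mxtrace pN v0)); rewrite ler_pM2r.
have : w^-1 ^+ 2 * qform (invmx Q) v < w^-1 ^+ 2 * (w * sqnorm v).
  by rewrite ltr_pM2l // exprn_gt0 // invr_gt0.
have -> : w^-1 ^+ 2 * (w * sqnorm v) = w^-1 * sqnorm v.
  by field; rewrite gt_eqF.
move: le0; rewrite -mulrA; lra.
Qed.

End PositiveMatrices.

(** * Deleting indices one at a time under a trace barrier *)

Section GreedyCompression.
Context {R : realFieldType}.

(* Cauchy-Schwarz for traces: the quadratic t |-> tr ((1 + t N Q) Q^-1 (1 + t Q N))
   is nonnegative; evaluate it at t = - w / tr N. *)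
Lemma mxtrace_inv_sqr_le n (Q : 'M[R]_n.+1) (w : R) (N := invmx (Q - w^-1%:M)) :
  posdef Q -> \tr (invmx Q) <= w -> posdef (Q - w^-1%:M) ->
  (\tr N) ^+ 2 <= w * \tr N + \tr (N *m N).
Proof.
move=> pQ trw pP; have uQ := posdef_unit pQ; have uP := posdef_unit pP.
have pN : posdef N := posdef_inv pP.
have t0 : 0 < \tr N := posdef_mxtrace_gt0 pN.
have w0 : 0 < w.
  by apply: lt_le_trans trw; apply/posdef_mxtrace_gt0/posdef_inv.
set t := \tr N in t0 *; pose s := - w / t.
pose B := 1%:M + s *: (Q *m N).
have BT : B^T = 1%:M + s *: (N *m Q).
  by rewrite /B linearD linearZ /= trmx1 trmx_mul (proj1 pN) (proj1 pQ).
have NQ : N *m Q = 1%:M + w^-1 *: N.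
  rewrite -[Q in LHS](subrK w^-1%:M) mulmxDr mulVmx //.
  by rewrite mul_mx_scalar.
have : 0 <= \tr (B^T *m invmx Q *m B).
  exact/mxtrace_congr_ge0/posdef_psd/posdef_inv.
have -> : B^T *m invmx Q *m B =
    invmx Q + (2 * s) *: N + (s ^+ 2) *: (N + w^-1 *: (N *m N)).
  rewrite BT mulmxDl mul1mx -scalemxAl mulmxK // /B mulmxDr mulmx1.
  rewrite -scalemxAr mulmxDl mulKmx // -scalemxAl mulmxA NQ mulmxDl mul1mx.
  rewrite -scalemxAl [s *: (N + _)]scalerDr scalerA -expr2 addrA; congr (_ + _).
  by rewrite -addrA -scalerDl mulrDl mul1r.
rewrite !mxtraceD !mxtraceZ mxtraceD mxtraceZ -/t.
set u := \tr (N *m N) => le0.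
have : 0 <= w + 2 * s * t + s ^+ 2 * (t + w^-1 * u).
  by apply: (le_trans le0); rewrite !lerD2r.
have -> : w + 2 * s * t + s ^+ 2 * (t + w^-1 * u) =
    (w / t ^+ 2) * (w * t + u - t ^+ 2).
  by rewrite /s; field; rewrite !gt_eqF.
by rewrite pmulr_rge0 ?divr_gt0 ?exprn_gt0 // subr_ge0.
Qed.

(** The inverse of the minor is [K], the Schur complement of [N i i] in [N]; summing its diagonal
    gives the formula. *)
Lemma mxtrace_inv_minor n (P : 'M[R]_n.+1) i (N := invmx P) :
  posdef P ->
  \tr (invmx (mxsub (lift i) (lift i) P)) = \tr N - (N *m N) i i / N i i.
Proof.
move=> pP; have uP := posdef_unit pP; have pN : posdef N := posdef_inv pP.
have Ni0 : N i i != 0 by rewrite gt_eqF ?posdef_diag_gt0.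
pose K := \matrix_(j, l)
  (N (lift i j) (lift i l) - N (lift i j) i * N i (lift i l) / N i i).
have uP' : mxsub (lift i) (lift i) P \in unitmx.
  by apply/posdef_unit/posdef_mxsub => //; exact: lift_inj.
have PN a b : \sum_j P a (lift i j) * N (lift i j) b =
    (a == b)%:R - P a i * N i b.
  have /matrixP/(_ a b) : P *m N = 1%:M by rewrite mulmxV.
  by rewrite !mxE (bigD1_ord i) //= => <-; rewrite addrC addrK.
have PK : mxsub (lift i) (lift i) P *m K = 1%:M.
  apply/matrixP => a b; rewrite mxE.
  under eq_bigr do rewrite !mxE mulrBr !mulrA.
  rewrite sumrB -!mulr_suml !PN !mxE (inj_eq (@lift_inj _ i)).
  rewrite [lift i a == i]eq_sym (negPf (neq_lift _ _)) sub0r; field.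
  exact: Ni0.
rewrite -[X in \tr X]mulmx1 -PK mulKmx //.
rewrite {1}/mxtrace; under eq_bigr do rewrite mxE.
rewrite sumrB -mulr_suml [\tr N](bigD1_ord i) //= [(N *m N) i i]mxE.
have -> : \sum_j N (lift i j) i * N i (lift i j) =
    \sum_j N i (lift i j) * N (lift i j) i.
  by apply: eq_bigr => j _; rewrite mulrC.
rewrite (bigD1_ord i) //=.
by field.
Qed.

(** Averaging: if every [i] failed, summing over [i] would give [tr (N N) < tr N (tr N - w)],
    against [mxtrace_inv_sqr_le]. *)
Lemma exists_minor_mxtrace_le n (Q : 'M[R]_n.+2) (w : R) :
  posdef Q -> \tr (invmx Q) <= w ->
  exists i (P := mxsub (lift i) (lift i) (Q - w^-1%:M)),
    posdef P /\ \tr (invmx P) <= w.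
Proof.
move=> pQ trw; have pP := posdef_sub_scalar pQ trw.
have := mxtrace_inv_sqr_le pQ trw pP.
set P := Q - _ in pP *; set N := invmx P => le0.
have pN : posdef N := posdef_inv pP.
have [/existsP[i le1]|/existsPn ltN] :=
  boolP [exists i, N i i * (\tr N - w) <= (N *m N) i i].
  exists i; split; first by apply: posdef_mxsub => //; exact: lift_inj.
  rewrite mxtrace_inv_minor // -/N lerBlDl addrC -lerBlDl.
  by rewrite ler_pdivlMr ?posdef_diag_gt0 // mulrC.
suff : \tr (N *m N) < \tr N * (\tr N - w).
  by move=> lt0; exfalso; move: lt0 le0; lra.
rewrite {1 2}/mxtrace mulr_suml; apply: ltr_sum => [|i _].
  by apply/hasP; exists ord0; rewrite ?mem_index_enum.
by rewrite ltNge ltN.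
Qed.

(** Induction on the number [j] of deletions, with [k] general. Since [k.+1] indices survive, each
    deletion starts from size at least 2. *)
Lemma greedy_compression n (H : 'M[R]_n) (x w : R) k j :
  (k.+1 + j)%N = n -> posdef (x%:M - H) -> \tr (invmx (x%:M - H)) <= w ->
  exists2 f : 'I_k.+1 -> 'I_n, injective f &
    let P := (x - j%:R / w)%:M - mxsub f f H in
    posdef P /\ \tr (invmx P) <= w.
Proof.
move=> + pQ trw; elim: j k => [|j IHj] k.
  rewrite addn0 => kn; subst n; exists id => //.
  by rewrite mul0r subr0 mxsub_id.
rewrite addnS -addSn => /IHj[f f_inj [pP trP]].
have [i []] := exists_minor_mxtrace_le pP trP.
have -> : mxsub (lift i) (lift i)
    ((x - j%:R / w)%:M - mxsub f f H - w^-1%:M) =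
    (x - j.+1%:R / w)%:M - mxsub (f \o lift i) (f \o lift i) H.
  apply/matrixP => a b; rewrite !mxE (inj_eq (@lift_inj _ i)).
  by rewrite addrAC -mulrnBl mulrSr mulrDl mul1r opprD addrA.
by move=> ? ?; exists (f \o lift i) => //; apply: inj_comp => //; exact: lift_inj.
Qed.

End GreedyCompression.

(** * Passing between row and column Gram matrices, and compressing a contraction *)

Section RectangularCompression.
Context {R : realFieldType}.

Lemma psd_conj m n (B : 'M[R]_(m, n)) M : psd M -> psd (B^T *m M *m B).
Proof. by move=> M0 v; rewrite qform_congr. Qed.

Lemma psd_gram m n (B : 'M[R]_(m, n)) : psd (B^T *m B).
Proof. by move=> v; rewrite qform_gram sqnorm_ge0. Qed.

Lemma qform_gramT m n (B : 'M[R]_(m, n)) v :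
  qform (B *m B^T) v = sqnorm (B^T *m v).
Proof. by rewrite -qform_gram trmxK. Qed.

(** Put [u = B v] and [t = x y]. The hypothesis at [u] gives [|B^T u|^2 < t |u|^2], and
    [0 <= |(t - B^T B) v|^2] turns this into [|u|^2 < t |v|^2]. *)
Lemma posdef_gram_swap m n (B : 'M[R]_(m, n)) (x y : R) : 0 < x -> 0 < y ->
  posdef (x%:M - y^-1 *: (B *m B^T)) -> posdef (y%:M - x^-1 *: (B^T *m B)).
Proof.
move=> x0 y0 [_ pX]; split=> [|v v0].
  by rewrite linearB linearZ /= tr_scalar_mx trmx_mul trmxK.
have s0 := sqnorm_gt0 v0.
rewrite qformD qformN qformZ qform_scalar qform_gram subr_gt0.
set u := B *m v; have [u0|u0] := eqVneq u 0.
  rewrite u0 /sqnorm big1 ?mulr0 ?mulr_gt0 // => i _.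
  by rewrite mxE expr0n.
have := pX _ u0; rewrite qformD qformN qformZ qform_scalar qform_gramT subr_gt0.
rewrite mulrC ltr_pdivrMr // => lt1.
set G := B^T *m B; have GT : G^T = G by rewrite trmx_mul trmxK.
pose t := x * y.
have := psd_gram (t%:M - G) v.
have -> : (t%:M - G)^T *m (t%:M - G) = (t ^+ 2)%:M - (2 * t) *: G + G^T *m G.
  have -> : (t%:M - G)^T = t%:M - G by rewrite linearB /= tr_scalar_mx GT.
  rewrite mulmxBl !mulmxBr !mul_scalar_mx mul_mx_scalar GT scale_scalar_mx.
  by rewrite -expr2 mulrDl mul1r scalerDl !opprD opprK !addrA.
rewrite !qformD qformN qformZ qform_scalar !qform_gram -mulmxA -/u => le0.
have : t * sqnorm u < t * (t * sqnorm v).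
  by move: le0 lt1; rewrite /t; lra.
rewrite ltr_pM2l ?mulr_gt0 // /t => lt2.
by rewrite mulrC ltr_pdivrMr //; move: lt2; lra.
Qed.

(** Woodbury's identity [Y^-1 = y^-1 (1 + y^-1 B^T X^-1 B)], followed by cyclicity of the trace. *)
Lemma mxtrace_gram_swap m n (B : 'M[R]_(m, n)) (x y : R)
    (X := x%:M - y^-1 *: (B *m B^T)) (Y := y%:M - x^-1 *: (B^T *m B)) :
  0 < x -> 0 < y -> X \in unitmx -> Y \in unitmx ->
  y * \tr (invmx Y) = x * \tr (invmx X) + n%:R - m%:R.
Proof.
move=> x0 y0 uX uY; have xn := lt0r_neq0 x0; have yn := lt0r_neq0 y0.
have BX : B *m B^T *m invmx X = (x * y) *: invmx X - y%:M.
  have /(congr1 (fun Z => y *: Z)) : X *m invmx X = 1%:M by rewrite mulmxV.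
  rewrite {1}/X mulmxBl mul_scalar_mx -scalemxAl scalerBr !scalerA divff //.
  by rewrite scale1r scalemx1 => <-; rewrite opprB addrCA mulrC subrr addr0.
have YV : Y *m (1%:M + y^-1 *: (B^T *m invmx X *m B)) = y%:M.
  rewrite mulmxDr mulmx1 -scalemxAr /Y mulmxBl mul_scalar_mx -scalemxAl.
  rewrite -!mulmxA [B *m _]mulmxA [B *m _ *m _]mulmxA BX mulmxBl mulmxBr.
  rewrite mul_scalar_mx -scalemxAl -!scalemxAr !scalerBr !scalerA.
  rewrite [y^-1 / x * (x * y)](_ : _ = 1); last by field; rewrite xn.
  rewrite mulVf // [y^-1 / x * y](_ : _ = x^-1); last by field; rewrite xn.
  by rewrite opprB [X in _ + X]addrCA subrr addr0 subrK.
have -> : y * \tr (invmx Y) = \tr (invmx Y *m y%:M).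
  by rewrite mul_mx_scalar mxtraceZ.
rewrite -YV mulKmx // mxtraceD mxtrace1 mxtraceZ mxtrace_mulC mulmxA BX.
rewrite linearB /= mxtraceZ mxtrace_scalar -mulr_natr; field.
by rewrite yn.
Qed.

Lemma posdef_sub_contraction m n (A : 'M[R]_(m, n)) (b : R) :
  1 < b -> psd (1%:M - A^T *m A) -> posdef (b%:M - b^-1 *: (A *m A^T)).
Proof.
move=> b1 pA; have b0 : 0 < b by lra.
(* The hypothesis controls [A^T A]; the swap for [A^T] with [x = y = b] transfers it to [A A^T]. *)
rewrite -[A in A *m _]trmxK; apply: posdef_gram_swap => //; rewrite trmxK.
split=> [|v v0]; first by rewrite linearB linearZ /= tr_scalar_mx trmx_mul trmxK.
have s0 := sqnorm_gt0 v0; have := pA v.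
rewrite !qformD !qformN qformZ !qform_scalar subr_gt0 qform_gram mul1r subr_ge0.
rewrite ltr_pdivrMl // => /le_lt_trans; apply.
have : 0 < (b * b - 1) * sqnorm v by rewrite mulr_gt0 //; nra.
by lra.
Qed.

(* The scalar inequality behind this is that the convex function
   s |-> (b - s / b)^-1 lies below its chord on [0, 1]. *)
Lemma mxtrace_inv_contraction_le m n (A : 'M[R]_(m, n)) (b : R) :
  1 < b -> psd (1%:M - A^T *m A) ->
  \tr (invmx (b%:M - b^-1 *: (A *m A^T))) <=
    m%:R / b + \tr (A *m A^T) / (b * (b ^+ 2 - 1)).
Proof.
move=> b1 pA; have b0 : 0 < b by lra.
have bn := lt0r_neq0 b0.
have bb : 0 < b ^+ 2 - 1 by nra.
have bbn := lt0r_neq0 bb.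
have pQ := posdef_sub_contraction b1 pA; have uQ := posdef_unit pQ.
have [NT _] := posdef_inv pQ.
set Q := b%:M - _ in pQ uQ NT *; set M := A *m A^T in Q pQ uQ NT *.
have MT : M^T = M by rewrite trmx_mul trmxK.
have [Y YE] : exists Y : 'M[R]_m, Y = M - M *m M by exists (M - M *m M).
have pY : psd Y.
  have -> : Y = A^T^T *m (1%:M - A^T *m A) *m A^T.
    by rewrite trmxK mulmxBr mulmxBl mulmx1 YE /M !mulmxA.
  exact: psd_conj.
have pMMM : psd ((1%:M - M)^T *m M *m (1%:M - M)).
  by apply: psd_conj => v; rewrite qform_gramT sqnorm_ge0.
(* A sum of two positive semidefinite terms, so that [tr (Q^-1 Y) = tr (Q^-1 (Y Q) Q^-1)] is
   nonnegative. *)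
have YQ : Y *m Q = (b - b^-1) *: Y + b^-1 *: ((1%:M - M)^T *m M *m (1%:M - M)).
  have -> : (1%:M - M)^T = 1%:M - M by rewrite linearB /= trmx1 MT.
  have -> : (1%:M - M) *m M *m (1%:M - M) = Y - Y *m M.
    have -> : (1%:M - M) *m M = Y by rewrite mulmxBl mul1mx YE.
    by rewrite mulmxBr mulmx1.
  by rewrite /Q mulmxBr mul_mx_scalar -scalemxAr scalerBl scalerBr addrA subrK.
pose e := (b ^+ 2 * (b ^+ 2 - 1))^-1.
have e0 : 0 < e by rewrite invr_gt0 mulr_gt0 ?exprn_gt0.
(* The second factor is the chord evaluated at [M]; it exceeds [Q^-1] by [e Q^-1 Y]. *)
have QW : Q *m (b^-1%:M + (b * (b ^+ 2 - 1))^-1 *: M) = 1%:M + e *: Y.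
  rewrite /Q mulmxBl !mulmxDr !mul_scalar_mx -!scalemxAl -!scalemxAr.
  rewrite scale_scalar_mx divff // mul_mx_scalar !scalerA opprD addrA.
  rewrite -[X in X - _ = _]addrA -scalerBl YE scalerBr addrA.
  congr (_ + _ *: _ - _ *: _); rewrite /e; field; rewrite ?bn ?bbn //.
have : 0 <= \tr (invmx Q *m Y).
  have -> : \tr (invmx Q *m Y) = \tr ((invmx Q)^T *m (Y *m Q) *m invmx Q).
    by rewrite NT !mulmxA mulmxK.
  apply: mxtrace_congr_ge0 => v; rewrite YQ qformD !qformZ.
  rewrite addr_ge0 // mulr_ge0 // ?invr_ge0 ?(ltW b0) //.
  by rewrite subr_ge0 -div1r ler_pdivrMr //; nra.
have /(congr1 (fun Z => \tr (invmx Q *m Z))) := QW.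
rewrite mulKmx // mulmxDr mulmx1 -scalemxAr !mxtraceD !mxtraceZ mxtrace_scalar.
rewrite -[b^-1 *+ m]mulr_natl [_^-1 * \tr M]mulrC => -> le0.
by rewrite lerDl mulr_ge0 // ltW.
Qed.

Lemma mxtrace_contraction_le n (A : 'M[R]_n) :
  psd (1%:M - A^T *m A) -> \tr (A *m A^T) <= n%:R.
Proof.
move=> /(mxtrace_congr_ge0 1%:M); rewrite trmx1 mul1mx mulmx1 linearB /= mxtrace1.
by rewrite subr_ge0 mxtrace_mulC.
Qed.

Lemma exists_small_submatrix d (A : 'M[R]_d) (b w : R) k j :
  (k.+1 + j)%N = d -> 1 < b -> psd (1%:M - A^T *m A) ->
  \tr (invmx (b%:M - b^-1 *: (A *m A^T))) <= w ->
  exists f g : 'I_k.+1 -> 'I_d, let x := b - j%:R / w in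
    [/\ injective f, injective g, 0 < x &
        forall u, sqnorm (mxsub f g A *m u) <= x ^+ 2 * sqnorm u].
Proof.
move=> kd b1 pA trw; have b0 : 0 < b by lra.
have pQ := posdef_sub_contraction b1 pA.
have w0 : 0 < w.
  apply: lt_le_trans trw; rewrite -kd in A pA pQ *.
  exact/posdef_mxtrace_gt0/posdef_inv.
have [f f_inj] := greedy_compression kd pQ trw.
set x := b - j%:R / w; cbv zeta.
have -> : mxsub f f (b^-1 *: (A *m A^T)) =
    b^-1 *: (rowsub f A *m (rowsub f A)^T).
  by rewrite trmx_mxsub -mxsub_mul; apply/matrixP => ? ?; rewrite !mxE.
set B := rowsub f A => -[pX trX].
(* Any nonzero vector would do: [B B^T] is positive semidefinite, so [X] can be positive there only
   if [x > 0]. *)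
have x0 : 0 < x.
  have v0 : const_mx 1 != 0 :> 'cV[R]_k.+1.
    by apply/eqP => /matrixP/(_ 0 0)/eqP; rewrite !mxE oner_eq0.
  have := proj2 pX _ v0; rewrite qformD qformN qformZ qform_scalar qform_gramT.
  rewrite subr_gt0 => lt0; rewrite -(pmulr_lgt0 _ (sqnorm_gt0 v0)).
  by apply: le_lt_trans lt0; rewrite mulr_ge0 ?sqnorm_ge0 // invr_ge0 ltW.
have pY := posdef_gram_swap x0 b0 pX.
(* The swap gives [b tr Y^-1 = x tr X^-1 + j <= x w + j = b w], so the column stage starts with the
   same [w]. *)
have trY : \tr (invmx (b%:M - x^-1 *: (B^T *m B))) <= w.
  have dE : d%:R = k.+1%:R + j%:R :> R by rewrite -kd natrD.
  have bw : b * w = x * w + j%:R by rewrite /x mulrBl divfK ?gt_eqF // subrK.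
  rewrite -(ler_pM2l b0) mxtrace_gram_swap ?posdef_unit // dE bw.
  by rewrite [k.+1%:R + _]addrC addrA addrK lerD2r ler_pM2l.
have [g g_inj] := greedy_compression kd pY trY.
rewrite -/x; cbv zeta.
have -> : mxsub g g (x^-1 *: (B^T *m B)) =
    x^-1 *: ((mxsub f g A)^T *m mxsub f g A).
  have -> : mxsub f g A = colsub g B by rewrite -mxsubcr.
  by rewrite [(colsub g B)^T]trmx_mxsub -mxsub_mul; apply/matrixP => ? ?; rewrite !mxE.
(* The [j] column deletions lower the barrier from [b] to [x] again, while the Gram matrix carries
   the factor [1/x]; hence the bound [x ^+ 2]. *)
move=> [/posdef_psd pZ _]; exists f, g; split=> // u.
have := pZ u; rewrite qformD qformN qformZ qform_scalar qform_gram subr_ge0.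
by rewrite mulrC ler_pdivrMr // => ?; rewrite expr2; lra.
Qed.

End RectangularCompression.

(** * Spectral and Frobenius norms, and submatrices indexed by sets *)

Section SpectralNorm.
Local Open Scope classical_set_scope.
Context {R : realType}.

Lemma sqnorm0 n : sqnorm (0 : 'cV[R]_n) = 0.
Proof. by rewrite /sqnorm big1 // => i _; rewrite mxE expr0n. Qed.

Lemma sqnormZ n a (v : 'cV[R]_n) : sqnorm (a *: v) = a ^+ 2 * sqnorm v.
Proof.
by rewrite /sqnorm mulr_sumr; apply: eq_bigr => i _; rewrite mxE exprMn.
Qed.

Lemma vnorm_le n (v : 'cV[R]_n) x : 0 <= x -> (vnorm v <= x) = (sqnorm v <= x ^+ 2).
Proof.
by move=> x0; rewrite -{1}(ger0_norm x0) -sqrtr_sqr ler_sqrt ?sqr_ge0.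
Qed.

Lemma vnorm_le1 n (v : 'cV[R]_n) : (vnorm v <= 1) = (sqnorm v <= 1).
Proof. by rewrite vnorm_le // expr1n. Qed.

Lemma spec_norm_le m n (C : 'M[R]_(m, n)) (x : R) : 0 <= x ->
  (forall u, sqnorm (C *m u) <= x ^+ 2 * sqnorm u) -> spec_norm C <= x.
Proof.
move=> x0 Cx; apply: ge_sup => [|_ [u /= + <-]].
  by exists (vnorm (C *m 0)), 0 => //=; rewrite vnorm_le1 sqnorm0.
rewrite vnorm_le1 vnorm_le // => u1; apply: (le_trans (Cx u)).
by rewrite ler_piMr ?sqr_ge0.
Qed.

(** Makes the [sup] in [spec_norm] a genuine upper bound. Entries of a vector in the unit ball are
    at most 1 in absolute value. *)
Lemma spec_norm_has_ubound m n (A : 'M[R]_(m, n)) :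
  has_ubound [set vnorm (A *m x) | x in [set x : 'cV[R]_n | vnorm x <= 1]].
Proof.
exists (Num.sqrt (\sum_i (\sum_j `|A i j|) ^+ 2)) => _ [x /= + <-].
rewrite vnorm_le1 => x1.
rewrite /vnorm ler_wsqrtr // ler_sum // => i _.
rewrite -[leLHS]real_normK ?num_real // lerXn2r ?nnegrE ?sumr_ge0 //.
rewrite mxE; apply: (le_trans (ler_norm_sum _ _ _)); apply: ler_sum => j _.
rewrite normrM ler_piMr // -(@expr_le1 _ 2) //.
rewrite real_normK ?num_real //; apply: le_trans x1.
by rewrite /sqnorm (bigD1 j) //= lerDl sumr_ge0 // => l _; exact: sqr_ge0.
Qed.

Lemma psd_spec_norm_le1 m n (A : 'M[R]_(m, n)) :
  spec_norm A <= 1 -> psd (1%:M - A^T *m A).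
Proof.
move=> A1 v; rewrite qformD qformN qform_scalar qform_gram mul1r subr_ge0.
have [->|v0] := eqVneq v 0; first by rewrite mulmx0 !sqnorm0.
have s0 := sqnorm_gt0 v0; set a := (vnorm v)^-1.
have a2 : a ^+ 2 = (sqnorm v)^-1 by rewrite exprVn sqr_sqrtr ?sqnorm_ge0.
have : sqnorm (A *m (a *: v)) <= 1.
  rewrite -vnorm_le1; apply: le_trans A1; apply: ub_le_sup => /=.
    exact: spec_norm_has_ubound.
  by exists (a *: v) => //=; rewrite vnorm_le1 sqnormZ a2 mulVf ?gt_eqF.
by rewrite -scalemxAr sqnormZ a2 ler_pdivrMl // mulr1.
Qed.

Lemma frob_norm_sqr m n (A : 'M[R]_(m, n)) : frob_norm A ^+ 2 = \tr (A *m A^T).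
Proof.
rewrite sqr_sqrtr.
  by apply: eq_bigr => i _; rewrite mxE; apply: eq_bigr => j _; rewrite mxE expr2.
by do 2!apply: sumr_ge0 => ? _; exact: sqr_ge0.
Qed.

Lemma frob_norm_eq0 m n (A : 'M[R]_(m, n)) : frob_norm A = 0 -> A = 0.
Proof.
move=> /eqP; rewrite sqrtr_eq0 => le0; apply/matrixP => i j; rewrite mxE.
apply/eqP; rewrite -sqrf_eq0 eq_le sqr_ge0 andbT; apply: le_trans le0.
rewrite (bigD1 i) //= (bigD1 j) //= -addrA lerDl.
by rewrite addr_ge0 ?sumr_ge0 // => *; rewrite ?sumr_ge0 // => *; exact: sqr_ge0.
Qed.

Lemma sqnorm_rowsub m n (p : 'I_m -> 'I_n) (v : 'cV[R]_n) :
  bijective p -> sqnorm (rowsub p v) = sqnorm v.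
Proof.
move=> p_bij; rewrite [RHS]/sqnorm (reindex p) /=; last exact: onW_bij.
by apply: eq_bigr => i _; rewrite mxE.
Qed.

(** [subm] lists a set in its [enum_val] order, whereas [f] lists its image in an arbitrary order;
    [p] converts between the two. *)
Lemma enum_val_imset_bij k n (f : 'I_k -> 'I_n) (S := f @: 'I_k) :
  injective f -> exists2 p : 'I_k -> 'I_#|S|, bijective p &
    forall i, enum_val (p i) = f i.
Proof.
move=> f_inj; have fS i : f i \in S by apply: imset_f.
pose p i := enum_rank_in (fS i) (f i).
have pE i : enum_val (p i) = f i by apply: enum_rankK_in.
exists p => //; apply: inj_card_bij => [i j pij|]; last first.
  by rewrite !card_ord card_imset // card_ord.
by apply: f_inj; rewrite -!pE pij.
Qed.

(** On the images of [f] and [g], [subm] is [mxsub f g A] up to permuting rows and columns, which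
    preserves [sqnorm]. *)
Lemma exists_subm_spec_norm_le k m n (A : 'M[R]_(m, n))
    (f : 'I_k -> 'I_m) (g : 'I_k -> 'I_n) (x : R) :
  injective f -> injective g -> 0 <= x ->
  (forall u : 'cV[R]_k, sqnorm (mxsub f g A *m u) <= x ^+ 2 * sqnorm u) ->
  exists (S : {set 'I_m}) (T : {set 'I_n}),
    [/\ #|S| = k, #|T| = k & spec_norm (subm A S T) <= x].
Proof.
move=> f_inj g_inj x0 fgx.
exists (f @: 'I_k)%SET, (g @: 'I_k)%SET.
split; rewrite ?card_imset ?card_ord //; apply: spec_norm_le => // u.
have [p p_bij pE] := enum_val_imset_bij f_inj.
have [q q_bij qE] := enum_val_imset_bij g_inj.
rewrite -(sqnorm_rowsub u q_bij) -(sqnorm_rowsub _ p_bij).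
apply: le_trans (fgx _); rewrite le_eqVlt; apply/orP; left; apply/eqP.
congr sqnorm; apply/matrixP => i l; rewrite !mxE (reindex q) /=; last exact: onW_bij.
by apply: eq_bigr => j _; rewrite !mxE pE qE.
Qed.

End SpectralNorm.

(* The right-hand side is [x] times the integral of [1 / (b - t)] against the
   probability measure on [{1, -beta}] with mean 0 and variance [beta]. *)
Lemma chord_le_two_atoms (R : realFieldType) (x b beta : R) :
  0 <= x -> 1 < b -> 0 <= beta -> beta <= 1 ->
  x / b + beta * x / (b * (b ^+ 2 - 1)) <=
    x * (b + beta - 1) / ((b - 1) * (b + beta)).
Proof.
move=> x0 b1 beta0 beta1; rewrite -subr_ge0.
have [b0 bm bp bb] : [/\ 0 < b, 0 < b - 1, 0 < b + 1 & 0 < b + beta].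
  by split; lra.
have -> : x * (b + beta - 1) / ((b - 1) * (b + beta)) -
    (x / b + beta * x / (b * (b ^+ 2 - 1))) =
    x * beta * (1 - beta) / (b * (b - 1) * (b + 1) * (b + beta)).
  have b2 : b ^+ 2 - 1 = (b - 1) * (b + 1) by ring.
  by rewrite b2; field; rewrite !gt_eqF.
by rewrite divr_ge0 // ?mulr_ge0 ?subr_ge0 // ltW.
Qed.

(** * Choice of the barrier and evaluation of the bound *)

Theorem theorem1p4 (R : realType) (d : nat) (A : 'M[R]_d) (k : nat) :
  spec_norm A <= 1 ->
  let beta := (frob_norm A) ^+ 2 / d%:R in
  (0 < k)%N ->
  k%:R < d%:R / (beta + 1) ->
  exists S T : {set 'I_d},
    [/\ #|S| = k, #|T| = k &
      spec_norm (subm A S T) <=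
        (1 - beta) * (k%:R / d%:R)
        + 2 * Num.sqrt ((1 - k%:R / d%:R) * (k%:R / d%:R) * beta)].
Proof.
move=> A1 beta; case: k => // k _ kd; have pA := psd_spec_norm_le1 A1.
have d0 : 0 < d%:R :> R.
  rewrite lt_def ler0n andbT; apply/eqP => d0.
  by move: kd; rewrite d0 mul0r ltNge ler0n.
have dn := lt0r_neq0 d0.
have k0R : 0 < k.+1%:R :> R by rewrite ltr0Sn.
have beta0 : 0 <= beta by rewrite divr_ge0 ?sqr_ge0 ?ltW.
have trA : \tr (A *m A^T) = beta * d%:R by rewrite -frob_norm_sqr divfK.
have beta1 : beta <= 1.
  by rewrite ler_pdivrMr // mul1r frob_norm_sqr; exact: mxtrace_contraction_le.
have kbd : k.+1%:R * (beta + 1) < d%:R by rewrite -ltr_pdivlMr //; lra.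
have le_kd : (k < d)%N by rewrite -(ler_nat R); nra.
set c := k.+1%:R / d%:R.
have c0 : 0 < c by rewrite divr_gt0.
have cn := lt0r_neq0 c0.
have kE : k.+1%:R = c * d%:R by rewrite divfK.
have cb : c * (beta + 1) < 1 by rewrite mulrAC ltr_pdivrMr ?mul1r.
(* For [beta = 0] the optimal [s] below would vanish and give [b = 1]; but then [A = 0], and the
   first rows and columns serve. *)
have [b0|bn] := eqVneq beta 0.
  have A0 : A = 0.
    apply: frob_norm_eq0; apply/eqP; rewrite -sqrf_eq0.
    by move/eqP: b0; rewrite mulf_eq0 invr_eq0 (negPf dn) orbF.
  apply: (@exists_subm_spec_norm_le _ k.+1 _ _ _ (widen_ord le_kd) (widen_ord le_kd)).
  - by move=> i j ij; apply: val_inj; exact: (congr1 val ij).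
  - by move=> i j ij; apply: val_inj; exact: (congr1 val ij).
  - by rewrite b0 mulr0 sqrtr0; lra.
  by move=> u; rewrite A0 mxsub_const mul0mx sqnorm0 mulr_ge0 ?sqr_ge0 ?sqnorm_ge0.
have {beta0}beta0 : 0 < beta by rewrite lt_def bn.
have c1 : c < 1 by nra.
have rad0 : 0 < (1 - c) * beta / c by rewrite divr_gt0 // mulr_gt0 // subr_gt0.
(* [s] minimises [c * s + (1 - c) * beta / s], the bound that the barrier
   [b = s + 1 - beta] yields. *)
pose s := Num.sqrt ((1 - c) * beta / c).
have s2 : s ^+ 2 = (1 - c) * beta / c by rewrite sqr_sqrtr // ltW.
(* After squaring this is [c (beta + 1) < 1], the hypothesis on [k]; it is what makes [b > 1]. *)
have s_beta : beta < s.
  rewrite -[ltLHS]ger0_norm ?(ltW beta0) // -sqrtr_sqr ltr_sqrt //.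
  by rewrite ltr_pdivlMr //; nra.
have s0 : 0 < s by lra.
have sn := lt0r_neq0 s0.
pose b := s + 1 - beta; have b1 : 1 < b by rewrite /b; lra.
pose w := d%:R * (b + beta - 1) / ((b - 1) * (b + beta)).
have trw : \tr (invmx (b%:M - b^-1 *: (A *m A^T))) <= w.
  apply: (le_trans (mxtrace_inv_contraction_le b1 pA)).
  by rewrite trA; apply: chord_le_two_atoms; rewrite // ltW.
have [f [g [f_inj g_inj x0 fgx]]] :=
  exists_small_submatrix (subnKC le_kd) b1 pA trw.
suff <- : b - (d - k.+1)%:R / w =
    (1 - beta) * c + 2 * Num.sqrt ((1 - c) * c * beta).
  by apply: (exists_subm_spec_norm_le f_inj g_inj) => //; exact: ltW.
have -> : Num.sqrt ((1 - c) * c * beta) = c * s.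
  have -> : (1 - c) * c * beta = (c * s) ^+ 2 by rewrite exprMn s2; field.
  by rewrite sqrtr_sqr ger0_norm // mulr_ge0 // ltW.
(* Here [b - 1 = s - beta] and [b + beta = s + 1], so [1/w = (s - beta) (s + 1) / (d s)]. *)
have -> : (d - k.+1)%:R / w = (1 - c) * (s - beta) * (s + 1) / s.
  rewrite natrB // kE /w /b; field.
  by rewrite sn dn !gt_eqF //; lra.
(* [(1 - c) beta] is written with the factor [(1 - c) * beta / c] so that [s2] turns the last term
   into [c s]. *)
have -> : (1 - c) * (s - beta) * (s + 1) / s =
    (1 - c) * (s + 1 - beta) - c * ((1 - c) * beta / c) / s.
  by field; rewrite cn sn.
by rewrite -s2 /b; field.
Qed.
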